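(* Let $G=\{x\rightarrow y,\ y\rightarrow py\}$, where $p$ is a parameter (a constant for $D_G$). For any $n\geqslant 1$, $$(xD_{G})^n\big|_{D_{G}=q}=\sum_{\pi\in\mathfrak{S}_n}x^{n-\operatorname{exc}(\pi)}y^{\operatorname{exc}(\pi)}p^{\operatorname{cdes}(\pi)}q^{\operatorname{cyc}(\pi)}.$$ When $p=1$, it reduces to $(xD_{G})^n\big|_{p=1,\,D_{G}=q}=A_n(x,y,q)$.
   Context: Grammars: a grammar $G$ on commuting variables is a set of substitution rules $v\rightarrow f_v$ (one for each variable $v$); $D_G$ is the derivation (linear, obeying the Leibniz rule, killing constants and parameters) on functions (e.g. polynomials) in the variables with $D_G(v)=f_v$. For a function $w$, $wD_G$ is the operator $f\mapsto w\,D_G(f)$, and $(wD_G)^n$ is its $n$-fold composition. Its normal ordered form is an expansion $\sum_k c_k D_G^k$ with the coefficient functions $c_k$ (acting by multiplication) to the left of the powers $D_G^k$. The notation $|_{D_G=q}$ means: write the operator in normal ordered form $\sum_k c_kD_G^k$ and replace $D_G^k$ by $q^k$, where $q$ is an indeterminate. $\mathfrak{S}_n$ is the symmetric group on $[n]=\{1,\dots,n\}$. $\operatorname{exc}(\pi)=\#\{i:\pi(i)>i\}$; $\operatorname{cyc}(\pi)$ is the number of cycles of $\pi$ (fixed points included). Write $\pi$ in standard cycle form: each cycle is written with its smallest element first and cycles are in increasing order of their first elements. $\operatorname{cdes}(\pi)$ is the number of pairs $(a,b)$ such that $a$ is the element written immediately before $b$ in its (so written) cycle and $a>b$ (no wrap-around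 from the last to the first element). Example: $\operatorname{cdes}((1,4,2)(3,5,7)(6,9,8))=2$. $A_n(x,y,z)=\sum_{k=1}^n\sum_{\ell=k}^nA_{n,k,\ell}x^\ell y^{n-\ell}z^k$, where the $A_{n,k,\ell}$ are the coefficients in the normal ordered expansion $(xD_{G'})^n=\sum_{k=1}^n\sum_{\ell=k}^nA_{n,k,\ell}x^\ell y^{n-\ell}D_{G'}^k$ for the grammar $G'=\{x\rightarrow y,\ y\rightarrow y\}$; they satisfy $A_{n+1,k,\ell}=\ell A_{n,k,\ell}+(n-\ell+1)A_{n,k,\ell-1}+A_{n,k-1,\ell-1}$ with $A_{1,1,1}=1$ and $A_{1,k,\ell}=0$ if $(k,\ell)\ne(1,1)$. *)

(* Defs.v *)
From mathcomp Require Import all_boot all_algebra all_fingroup ring.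
From mathcomp Require Export mpoly.

Set Implicit Arguments.
Unset Strict Implicit.
Unset Printing Implicit Defensive.

Import GRing.Theory.
Local Open Scope ring_scope.

Section Grammars.
Variables (R : idomainType) (m : nat).
Implicit Types (g : 'I_m -> {mpoly R[m]}) (D : {mpoly R[m]} -> {mpoly R[m]}).

(* A grammar on m commuting variables is the map g sending a variable to its
   substitute; the constants and the parameters are the elements of R. *)
Definition is_grammar_derivation g D : Prop :=
  [/\ linear D,
      forall f h, D (f * h) = D f * h + f * D h,
      forall c, D c%:MP = 0
    & forall i, D 'X_i = g i].

Definition wD_pow D (w : {mpoly R[m]}) (n : nat) (f : {mpoly R[m]}) :=
  iter n (fun h => w * D h) f.

(* The normal ordered operator \sum_k c_k D^k is encoded by the polynomial
   N = \sum_k c_k q^k in an indeterminate q, so that N is also the outcome of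
   the substitution of q^k for D^k. *)
Definition is_normal_ordered_form D (T : {mpoly R[m]} -> {mpoly R[m]})
    (N : {poly {mpoly R[m]}}) : Prop :=
  forall f, T f = \sum_(k < size N) N`_k * iter k D f.

Lemma grammar_derivation_exists g :
  is_grammar_derivation g (fun f => \sum_i g i * f^`M(i)).
Proof.
split.
- move=> c f h; rewrite scaler_sumr -big_split; apply: eq_bigr => i _ /=.
  by rewrite mderivD mderivZ mulrDr scalerAr.
- move=> f h; rewrite mulr_suml mulr_sumr -big_split; apply: eq_bigr => i _ /=.
  by rewrite mderivM mulrDr !mulrA [g i * f]mulrC.
- by move=> c; rewrite big1 // => i _; rewrite mderivC mulr0.
- move=> i; rewrite (bigD1 i) //= big1 => [|j ji].
    by rewrite mderivX mnm1E eqxx addr0 scale1r -{1}[U_(i)%MM]add0m addmK mpolyX0 mulr1.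
  by rewrite mderivX mnm1E eq_sym (negPf ji) scale0r mulr0.
Qed.

End Grammars.

Section TwoVariables.
Variable R : idomainType.

Definition var_x : {mpoly R[2]} := 'X_(@Ordinal 2 0 isT).
Definition var_y : {mpoly R[2]} := 'X_(@Ordinal 2 1 isT).

Definition grammarG (p : R) (i : 'I_2) : {mpoly R[2]} :=
  if val i == 0%N then var_y else p *: var_y.

Definition grammarG' (i : 'I_2) : {mpoly R[2]} := var_y.

Definition is_A_coefficients (n : nat) (A : nat -> nat -> R) : Prop :=
  forall D, is_grammar_derivation grammarG' D ->
  forall f, wD_pow D var_x n f =
    \sum_(1 <= k < n.+1) \sum_(k <= l < n.+1)
       A k l *: (var_x ^+ l * var_y ^+ (n - l)) * iter k D f.

(* A_n(x, y, q), with q the indeterminate of the outer polynomial ring. *)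
Definition A_poly (n : nat) (A : nat -> nat -> R) : {poly {mpoly R[2]}} :=
  \sum_(1 <= k < n.+1) \sum_(k <= l < n.+1)
     (A k l *: (var_x ^+ l * var_y ^+ (n - l)))%:P * 'X^k.

End TwoVariables.

Arguments var_x {R}.
Arguments var_y {R}.

(* Permutations act on {0, ..., n-1} instead of {1, ..., n}; the statistics only
   depend on the relative order. *)
Section PermutationStatistics.
Variable n : nat.
Implicit Type s : 'S_n.

Definition exc s : nat := #|[set i : 'I_n | (i < s i)%N]|.

Definition cyc s : nat := #|porbits s|.

(* Each cycle is written i, s i, s (s i), ... starting from its smallest element
   i; enum 'I_n is increasing. *)
Definition standard_cycle_form s : seq (seq 'I_n) :=
  [seq traject s i #|porbit s i| | i <- enum 'I_n
     & [forall j in porbit s i, (i <= j)%N]].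

Definition descents (w : seq 'I_n) : nat :=
  count (fun ab : 'I_n * 'I_n => (ab.2 < ab.1)%N) (zip w (behead w)).

Definition cdes s : nat := \sum_(w <- standard_cycle_form s) descents w.

End PermutationStatistics.

(* This recurrence gives the coefficients A_{n,k,l}, so that they exist; its
   value at n = 1 is 1 if k = l = 1 and 0 otherwise. *)
Fixpoint A_rec (n k l : nat) : nat :=
  if n is m.+1 then
    (l * A_rec m k l
     + (if l is l'.+1 then (m - l') * A_rec m k l' else 0)
     + (if k is k'.+1 then if l is l'.+1 then A_rec m k' l' else 0 else 0))%N
  else ((k == 0%N) && (l == 0%N))%N.

Lemma A_rec_gt n k l : (n < l)%N -> A_rec n k l = 0%N.
Proof.
elim: n k l => [|n IH] k [|l] //=; first by rewrite andbF.
rewrite ltnS => nl; rewrite !IH //; last exact: ltnW.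
by case: k => [|k]; rewrite !muln0 ?IH.
Qed.

Lemma A_rec_lt n k l : (l < k)%N -> A_rec n k l = 0%N.
Proof.
elim: n k l => [|n IH] [|k] [|l] //= lk.
by rewrite !IH ?muln0 // ltnW.
Qed.

Lemma A_rec_top n l : A_rec n n.+1 l = 0%N.
Proof.
by have [ln|nl] := leqP l n; [rewrite A_rec_lt | rewrite A_rec_gt].
Qed.

Lemma A_rec0 n l : (0 < n)%N -> A_rec n 0 l = 0%N.
Proof.
elim: n l => [//|[|n] IH] l _; first by case: l => [|[|l]] //=; rewrite !muln0.
rewrite [LHS]/= -/(A_rec n.+1 0 l) IH // muln0; case: l => //= l.
by rewrite -/(A_rec n.+1 0 l) IH // muln0.
Qed.

Lemma A_coefficients_exist (R : idomainType) n : (0 < n)%N ->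
  is_A_coefficients n (fun k l => (A_rec n k l)%:R : R).
Proof.
move=> n_gt0 D [Dlin DM DC DX] f.
pose T n k l : {mpoly R[2]} :=
  (var_x ^+ l * var_y ^+ (n - l) * iter k D f) *+ A_rec n k l.
have DD : {morph D : u v / u + v}.
  by move=> u v; have := Dlin 1 u v; rewrite !scale1r.
have D0 : D 0 = 0 by have := DC 0; rewrite mpolyC0.
have Dsum (I : Type) (r : seq I) (F : I -> {mpoly R[2]}) :
  D (\sum_(i <- r) F i) = \sum_(i <- r) D (F i).
  by elim: r => [|i r IH]; rewrite ?big_nil // !big_cons DD IH.
have DMn k u : D (u *+ k) = D u *+ k.
  by elim: k => [|k IH]; rewrite ?mulr0n // !mulrS DD IH.
have D1 : D 1 = 0 by rewrite -mpolyC1 DC.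
have Dexp (u : {mpoly R[2]}) l :
    D (u ^+ l) = (u ^+ l.-1 * D u) *+ l.
  elim: l => [|l IH]; first by rewrite expr0 D1.
  rewrite exprS DM IH mulrS mulrC; congr (_ + _).
  by case: l {IH} => [|l] /=; rewrite ?mulr0n ?mulr0 // mulrnAr mulrA -exprS.
have main j : wD_pow D var_x j f = \sum_(k < j.+1) \sum_(l < j.+1) T j k l.
  elim: j => [|j IH].
    by rewrite /wD_pow /= !big_ord1 /T /= !expr0 !mul1r.
  rewrite /wD_pow iterS -/(wD_pow _ _ _ _) IH Dsum mulr_sumr.
  pose a k l : {mpoly R[2]} :=
    (var_x ^+ l * var_y ^+ (j.+1 - l) * iter k D f) *+ (l * A_rec j k l).
  pose b k l : {mpoly R[2]} :=
    (var_x ^+ l.+1 * var_y ^+ (j - l) * iter k D f) *+ ((j - l) * A_rec j k l).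
  pose c k l : {mpoly R[2]} :=
    (var_x ^+ l.+1 * var_y ^+ (j - l) * iter k.+1 D f) *+ A_rec j k l.
  have step k l : (l <= j)%N -> var_x * D (T j k l) = a k l + b k l + c k l.
    move=> lj; rewrite /T /a /b /c DMn !DM !Dexp !DX /grammarG' -iterS.
    rewrite [LHS]mulrnAr 2!mulrnA -!mulrnDl; congr (_ *+ _).
    move: (iter k D f) (iter k.+1 D f) => u v.
    have -> : var_y ^+ (j.+1 - l) = var_y * var_y ^+ (j - l) :> {mpoly R[2]}.
      by rewrite subSn // exprS.
    by case: l {lj} (j - l)%N => [|l] [|r] /=; rewrite ?expr0 ?exprS; ring.
  transitivity (\sum_(k < j.+1) \sum_(l < j.+1) (a k l + b k l + c k l)).
    apply: eq_bigr => k _; rewrite Dsum mulr_sumr.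
    by apply: eq_bigr => l _; rewrite step // -ltnS.
  pose b' k l := if l is l'.+1 then b k l' else 0.
  pose c' k l := if k is k'.+1 then if l is l'.+1 then c k' l' else 0 else 0.
  have -> : \sum_(k < j.+2) \sum_(l < j.+2) T j.+1 k l
          = \sum_(k < j.+2) \sum_(l < j.+2) (a k l + b' k l + c' k l).
    apply: eq_bigr => k _; apply: eq_bigr => l _.
    rewrite /T /= 2!mulrnDr; congr (_ + _ + _).
      by case: (val l) => [|l'] //=; rewrite /b subSS.
    by case: (val k) (val l) => [|k'] [|l'] //=; rewrite /c subSS.
  have split3 (r t : nat) (F1 F2 F3 : nat -> nat -> {mpoly R[2]}) :
     \sum_(k < r) \sum_(l < t) (F1 k l + F2 k l + F3 k l) =
     \sum_(k < r) \sum_(l < t) F1 k l + \sum_(k < r) \sum_(l < t) F2 k l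
     + \sum_(k < r) \sum_(l < t) F3 k l.
    by rewrite -!big_split; apply: eq_bigr => k _; rewrite -!big_split.
  rewrite !split3; congr (_ + _ + _).
  - rewrite [RHS]big_ord_recr /= [X in _ + X]big1 ?addr0 => [|l _].
      apply: eq_bigr => k _; rewrite [RHS]big_ord_recr /= [a k j.+1]/a.
      by rewrite A_rec_gt // muln0 addr0.
    by rewrite /a A_rec_top muln0.
  - rewrite [RHS]big_ord_recr /= [X in _ + X]big1 ?addr0 => [|[[|l] lj] _ //=].
      by apply: eq_bigr => k _; rewrite [RHS]big_ord_recl add0r.
    by rewrite /b A_rec_top muln0.
  rewrite [RHS]big_ord_recl /= [X in X + _]big1 // add0r.
  by apply: eq_bigr => k _; rewrite [RHS]big_ord_recl add0r.
rewrite main -(big_mkord xpredT (fun k => \sum_(l < n.+1) T n k l)).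
rewrite big_ltn // [X in X + _]big1 ?add0r => [|l _]; last first.
  by rewrite /T A_rec0.
apply: eq_big_nat => k /andP[_ kn].
rewrite -(big_mkord xpredT (T n k)) (big_cat_nat (n := k)) //= 1?ltnW //.
rewrite [X in X + _]big_nat_cond [X in X + _]big1 ?add0r => [|l]; last first.
  by rewrite andbT => /andP[_ lk]; rewrite /T A_rec_lt // mulr0n.
by apply: eq_bigr => l _; rewrite /T scaler_nat mulrnAl.
Qed.

(* Main.v *)
Require Import Defs.
From HB Require Import structures.
From mathcomp Require Import all_boot all_algebra all_fingroup.
From mathcomp Require Import zify ring.

(** Multiplying by x after applying D acts on normal ordered monomials by
      x D (x^a y^b D^k f) = a x^a y^(b+1) D^k f + b p x^(a+1) y^b D^k f
                            + x^(a+1) y^b D^(k+1) f,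
    and this is the way in which the weight x^(n - exc) y^exc p^cdes D^cyc
    changes when the new maximum n+1 is inserted into a permutation s of [n].
    Opening a new cycle (n+1) produces the last term.  Inserting n+1 right after
    i in its cycle keeps the number of cycles.  If s(i) <= i, which happens for
    n - exc values of i, then i becomes an excedance, and no descent is created
    since i was either a descent or the last element of its cycle.  If i < s(i),
    which happens for exc values of i, then i stays an excedance and n+1 > s(i)
    is a new descent.  As every permutation of [n+1] arises exactly once, an
    induction on n gives the expansion of (xD)^n ([xD_pow_perm]).

    The effect on descents does not have to be followed in the standard cycle
    form, because cdes + exc + cyc = n ([cdes_exc_cyc]): the i with s(i) <= i
    are the descents and the last elements of the cycles.  Excedances and cycles
    are easy to follow under insertion.

    The expansion has to be the only normal ordered form of the operator
    ([normal_op_inj]).  In the algebra of operators, the commutator with the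
    multiplication by u is a derivation that kills multiplications and sends D
    to the multiplication by D u.  Its d-th iterate therefore kills D^k for
    k < d and sends D^d to d! (D u)^d.  Applied to an operator
    c_0 + ... + c_d D^d that vanishes, it gives c_d d! (D u)^d = 0, whence
    c_d = 0 in characteristic zero as soon as D u <> 0; here u = x works.

    When p = 1, the expansion that defines the coefficients of A_n is a normal
    ordered form of the same operator, and uniqueness applies again. *)

Set Implicit Arguments.
Unset Strict Implicit.
Unset Printing Implicit Defensive.

Import GRing.Theory.

(** * Counting cycle descents *)

Lemma excE m (s : 'S_m) : exc s = \sum_(i < m) (i < s i)%N.
Proof.
rewrite /exc -sum1dep_card big_mkcond.
by apply: eq_bigr => i _; case: ltnP.
Qed.

Section CycleDescents.
Variable n : nat.
Implicit Types (s : 'S_n) (i j : 'I_n).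

Definition cycle_min s i := [forall j in porbit s i, (i <= j)%N].

Lemma descents_traject (f : 'I_n -> 'I_n) i m :
  descents (traject f i m.+1) =
  \sum_(k < m) (iter k.+1 f i < iter k f i)%N.
Proof.
elim: m i => [|m IH] i; first by rewrite big_ord0.
have -> : descents (traject f i m.+2) =
    ((f i < i) + descents (traject f (f i) m.+1))%N by [].
rewrite IH big_ord_recl; congr (_ + _)%N.
by apply: eq_bigr => k _; rewrite -!iterSr.
Qed.

(** Going around the cycle, the steps that do not go up are the descents of the
    word and the closing step from its last element back to the minimum; this
    step is the plus one. *)
Lemma descents_cycle s i : cycle_min s i ->
  (descents (traject s i #|porbit s i|)).+1 =
  \sum_(j in porbit s i) (s j <= j)%N.
Proof.
move=> /forall_inP min_i.
have uniq_i := uniq_traject_porbit s i.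
rewrite (eq_bigl _ _ (porbit_traject s i)) -(big_uniq _ uniq_i) /=.
have closed_i := iter_porbit s i.
have: (0 < #|porbit s i|)%N by apply/card_gt0P; exists i; exact: porbit_id.
case: #|porbit s i| uniq_i closed_i => // m uniq_i closed_i _.
rewrite descents_traject (big_nth i) size_traject big_mkord big_ord_recr.
rewrite nth_traject // -iterS closed_i.
rewrite min_i -?permX ?mem_porbit // -addn1; congr (_ + _)%N.
apply: eq_bigr => k _.
(* Before the closing step, consecutive elements are distinct. *)
have lt_km := ltn_ord k.
rewrite nth_traject /= ?ltnS ?(ltnW lt_km) // ltn_neqAle.
suff -> : s (iter k s i) != iter k s i :> nat by [].
have := nth_uniq i (i := k.+1) (j := k) _ _ uniq_i.
rewrite size_traject !nth_traject ?ltnS ?(ltnW lt_km) // (inj_eq val_inj).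
by move=> /= -> //; lia.
Qed.

(** The minima index the cycles, which passes from the words of the standard
    cycle form to the sets of [porbits]. *)
Lemma sum_cycle_min s (F : {set 'I_n} -> nat) :
  \sum_(i | cycle_min s i) F (porbit s i) = \sum_(C in porbits s) F C.
Proof.
have -> : porbits s = [set porbit s i | i in cycle_min s].
  apply/setP => C; apply/imsetP/imsetP => [] [i im_i ->]; last by exists i.
  case: (arg_minnP (fun j : 'I_n => j : nat) (porbit_id s i)) => m s_m min_m.
  have eqC : porbit s i = porbit s m by apply/esym/eqP; rewrite eq_porbit_mem.
  by exists m => //; apply/forall_inP => j; rewrite -eqC => /min_m.
rewrite big_imset => [//|i j /forall_inP min_i /forall_inP min_j eq_ij].
have ij : (i <= j)%N by apply: min_i; rewrite eq_ij porbit_id.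
have ji : (j <= i)%N by apply: min_j; rewrite -eq_ij porbit_id.
by apply/val_inj/eqP; rewrite eqn_leq ij.
Qed.

(** Each i falls under one of three cases: an excedance if i < s i; otherwise a
    descent in the word of its cycle, or the last element of this word. *)
Lemma cdes_exc_cyc s : (cdes s + exc s + cyc s)%N = n.
Proof.
have -> : cdes s =
    \sum_(i | cycle_min s i) descents (traject s i #|porbit s i|).
  by rewrite /cdes /standard_cycle_form big_map big_filter big_enum_cond.
rewrite addnAC /cyc -sum1_card -(sum_cycle_min s (fun=> 1%N)) -big_split /=.
under eq_bigr => i min_i do rewrite addn1 descents_cycle //.
rewrite (sum_cycle_min s (fun C => \sum_(j in C) (s j <= j)%N)).
have <- : \sum_(j < n) (s j <= j)%N =
          \sum_(C in porbits s) \sum_(j in C) (s j <= j)%N.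
  rewrite (partition_big (porbit s) [in porbits s]) => [|j _]; last first.
    exact: imset_f.
  apply: eq_bigr => C /imsetP[i _ ->]; apply: eq_bigl => j.
  by rewrite eq_porbit_mem.
rewrite excE -big_split /=.
rewrite -[RHS]card_ord -sum1_card; apply: eq_bigr => j _.
by rewrite ltnNge; case: leqP.
Qed.

End CycleDescents.

(** * Inserting a new maximum into a permutation *)

Section Insertion.
Variable n : nat.
Implicit Types (s : 'S_n) (i : 'I_n) (j : 'I_n.+1).

(** For j < n, the cycle ... j, s j ... becomes ... j, n, s j ... (products of
    permutations apply the left factor first); for j = n the transposition is
    the identity and n is a new fixed point. *)
Definition insert_max s j : 'S_n.+1 :=
  (tperm j ord_max * lift_perm ord_max ord_max s)%g.

(** The position j is recovered as the preimage of the maximum, and then s by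
    cancelling the transposition; a count of the permutations does the rest. *)
Lemma insert_max_bij : bijective (fun sj => insert_max sj.1 sj.2).
Proof.
apply: inj_card_bij => [[s j] [s' j'] /= eq_ss'|]; last first.
  by rewrite card_prod !card_Sn card_ord factS mulnC.
have img_j (t : 'S_n) k : insert_max t k k = ord_max.
  by rewrite permM tpermL lift_perm_id.
have eq_j : j = j'.
  by apply: (@perm_inj _ (insert_max s j)); rewrite [in RHS]eq_ss' !img_j.
move: eq_ss'; rewrite -eq_j => /mulgI eq_ss'; congr (_, _).
apply/permP => i; apply: (@lift_inj _ ord_max).
by rewrite -!(lift_perm_lift ord_max) eq_ss'.
Qed.

Lemma exc_lift_max s : exc (lift_perm ord_max ord_max s) = exc s.
Proof.
rewrite !excE (bigD1_ord ord_max) // lift_perm_id ltnn [LHS]add0n.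
by apply: eq_bigr => i _; rewrite lift_perm_lift !lift_max.
Qed.

Lemma insert_max_at_max s : insert_max s ord_max = lift_perm ord_max ord_max s.
Proof. by rewrite /insert_max tperm1 mul1g. Qed.

(** The maximum is not an excedance, and i always becomes one. *)
Lemma exc_insert_max s i :
  exc (insert_max s (lift ord_max i)) = (exc s + (s i <= i))%N.
Proof.
rewrite !excE (bigD1_ord ord_max) // permM tpermR lift_perm_lift.
rewrite ltnNge -ltnS ltn_ord [LHS]add0n.
rewrite (bigD1 i) // [in RHS](bigD1 i) //.
rewrite permM tpermL lift_perm_id lift_max ltn_ord.
have -> : \sum_(k < n | k != i)
     (lift ord_max k < insert_max s (lift ord_max i) (lift ord_max k))%N =
   \sum_(k < n | k != i) (k < s k)%N.
  apply: eq_bigr => k ki.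
  rewrite permM tpermD ?lift_perm_lift ?lift_max // ?neq_lift //.
  by rewrite (inj_eq lift_inj) eq_sym.
by rewrite addnAC ltnNge; case: leqP.
Qed.

Lemma porbit_lift_max s i :
  porbit (lift_perm ord_max ord_max s) (lift ord_max i) =
  lift ord_max @: porbit s i.
Proof.
have expE k : ((lift_perm ord_max ord_max s ^+ k) (lift ord_max i))%g =
              lift ord_max ((s ^+ k) i)%g.
  elim: k => [|k IH]; rewrite ?expg0 ?perm1 //.
  by rewrite !expgSr !permM IH lift_perm_lift.
apply/setP => j; apply/porbitP/imsetP => [[k ->]|[i' /porbitP[k ->] ->]].
  by exists ((s ^+ k) i)%g; rewrite ?mem_porbit.
by exists k; rewrite expE.
Qed.

Lemma porbit_lift_max_max s :
  porbit (lift_perm ord_max ord_max s) ord_max = [set ord_max].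
Proof.
apply/setP => j; rewrite inE; apply/porbitP/eqP => [[k ->]|->]; last first.
  by exists 0%N; rewrite perm1.
by elim: k => [|k IH]; rewrite ?perm1 // expgSr permM IH lift_perm_id.
Qed.

Lemma cyc_lift_max s : cyc (lift_perm ord_max ord_max s) = (cyc s).+1.
Proof.
pose up (C : {set 'I_n}) : {set 'I_n.+1} := lift ord_max @: C.
have -> : cyc (lift_perm ord_max ord_max s) =
          #|[set ord_max] |: [set up C | C in porbits s]|.
  congr #|pred_of_set _|; apply/setP => C; rewrite !inE.
  apply/imsetP/orP => [[j _ ->]|[/eqP->|/imsetP[_ /imsetP[i _ ->] ->]]].
  - case: (unliftP ord_max j) => [i ->|->].
      by right; rewrite porbit_lift_max; apply/imset_f/imset_f.
    by left; rewrite porbit_lift_max_max.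
  - by exists ord_max; rewrite ?porbit_lift_max_max.
  by exists (lift ord_max i); rewrite ?porbit_lift_max.
rewrite cardsU1 card_imset; last exact/imset_inj/lift_inj.
suff -> : [set ord_max] \notin [set up C | C in porbits s] by [].
apply/imsetP => -[C _ /setP/(_ ord_max)]; rewrite inE eqxx.
by move/esym/imsetP => [i _] /eqP; rewrite (negPf (neq_lift _ _)).
Qed.

(** Multiplying by a transposition of points of distinct cycles joins these: the
    fixed point n is absorbed into the cycle of i. *)
Lemma cyc_insert_max s i : cyc (insert_max s (lift ord_max i)) = cyc s.
Proof.
set s' := lift_perm ord_max ord_max s.
have := porbits_mul_tperm s' (lift ord_max i) ord_max.
rewrite /= porbit_lift_max_max inE eq_sym neq_lift -!/(cyc _) cyc_lift_max /=.
by rewrite -/(insert_max _ _) -/(cyc _); lia.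
Qed.

End Insertion.

Local Open Scope ring_scope.

(** * Uniqueness of normal ordered forms *)

Section NormalOrdering.
Variables (A : idomainType) (D : {additive A -> A}).
Implicit Types (N : {poly A}) (f u c : A).

Definition normal_op N f := \sum_(k < size N) N`_k * iter k D f.

Lemma normal_op_widen N m f : (size N <= m)%N ->
  normal_op N f = \sum_(k < m) N`_k * iter k D f.
Proof.
move=> leNm; rewrite /normal_op.
rewrite (big_ord_widen m (fun k => N`_k * iter k D f)) //.
rewrite big_mkcond; apply: eq_bigr => k _; case: ltnP => // leNk.
by rewrite nth_default ?mul0r.
Qed.

Lemma normal_opD N N' f : normal_op (N + N') f = normal_op N f + normal_op N' f.
Proof.
pose m := maxn (size N) (size N').
rewrite !(@normal_op_widen _ m) ?size_polyD ?leq_maxl ?leq_maxr //.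
by rewrite -big_split; apply: eq_bigr => k _; rewrite coefD mulrDl.
Qed.

Lemma normal_op0 f : normal_op 0 f = 0.
Proof. by rewrite /normal_op size_poly0 big_ord0. Qed.

Lemma normal_opN N f : normal_op (- N) f = - normal_op N f.
Proof. by apply/eqP; rewrite -addr_eq0 -normal_opD addNr normal_op0. Qed.

Lemma normal_op_sum (I : Type) (r : seq I) (P : pred I) (F : I -> {poly A}) f :
  normal_op (\sum_(i <- r | P i) F i) f = \sum_(i <- r | P i) normal_op (F i) f.
Proof.
apply: (big_morph (normal_op^~ f)) => [N N'|]; first exact: normal_opD.
exact: normal_op0.
Qed.

Lemma normal_op_monomial c k f : normal_op (c%:P * 'X^k) f = c * iter k D f.
Proof.
have le_k : (size (c%:P * 'X^k)%R <= k.+1)%N.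
  by rewrite mul_polyC (leq_trans (size_scale_leq _ _)) ?size_polyXn.
rewrite (normal_op_widen _ le_k) big_ord_recr /= coefCM coefXn eqxx mulr1.
rewrite big1 ?add0r // => j _.
by rewrite coefCM coefXn ltn_eqF // mulr0 mul0r.
Qed.

Hypothesis DM : forall f h, D (f * h) = D f * h + f * D h.

Definition commutator_with u (T : A -> A) f := T (u * f) - u * T f.

Lemma iter_commutator_sum u (I : Type) (r : seq I)
    (c : I -> A) (T : I -> A -> A) j f :
  iter j (commutator_with u) (fun h => \sum_(i <- r) c i * T i h) f =
  \sum_(i <- r) c i * iter j (commutator_with u) (T i) f.
Proof.
elim: j f => [//|j IH] f; rewrite iterS /commutator_with !IH mulr_sumr -sumrB.
by apply: eq_bigr => i _; rewrite mulrBr mulrCA.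
Qed.

(** The Leibniz formula for the j-th power of the derivation ad = [ _, u] on the
    product D T.  Only two terms survive, because ad D is the multiplication by
    D u, which commutes with u. *)
Lemma iter_commutator_comp u (T : A -> A) j f :
  iter j (commutator_with u) (D \o T) f =
  (D u * iter j.-1 (commutator_with u) T f) *+ j
  + D (iter j (commutator_with u) T f).
Proof.
elim: j f => [|j IH] f; first by rewrite mulr0n add0r.
rewrite iterS {1}/commutator_with !IH.
rewrite [iter j.+1 _ T f]/(iter j _ T _ - u * iter j _ T f) raddfB DM /=.
by case: j {IH} => [|j]; rewrite ?iterS /commutator_with; ring.
Qed.

(** Each commutator with u turns one of the remaining factors D of D^k into the
    multiplication by D u: k commutators use up all factors, in k! orders, and
    one more gives zero. *)
Lemma iter_commutator_derivation u k j f : (k <= j)%N ->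
  iter j (commutator_with u) (iter k D) f =
  if j == k then (D u ^+ k * f) *+ k`! else 0.
Proof.
elim: k j f => [|k IH] [|j] f //.
- by rewrite expr0 mul1r.
- move=> _ /=; elim: j f => [|j IH] f; first by rewrite /commutator_with subrr.
  by rewrite iterS {1}/commutator_with !IH mulr0 subrr.
rewrite ltnS => le_kj; rewrite (iter_commutator_comp u (iter k D)) [j.+1.-1]/=.
rewrite !IH ?leqW // eqSS [j.+1 == k]gtn_eqF // raddf0 addr0.
case: eqP => [->|_]; rewrite ?mulr0 ?mul0rn //.
by rewrite factS mulrnA exprS mulrnAr mulrA mulrnAC.
Qed.

Hypothesis charA0 : forall m, (m%:R == 0 :> A) = (m == 0%N).

(** Iterated commutators with u isolate the top coefficient of a vanishing
    operator, up to the nonzero factor d! (D u)^d. *)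
Lemma normal_op_inj u N N' : D u != 0 ->
  normal_op N =1 normal_op N' -> N = N'.
Proof.
move=> Du_neq0 eqNN'; apply/eqP; rewrite -subr_eq0; apply/negPn/negP => nzN.
set M := N - N' in nzN.
have M0 f : normal_op M f = 0.
  by rewrite /M normal_opD normal_opN eqNN' subrr.
pose d := (size M).-1.
have sizeM : size M = d.+1 by rewrite /d prednK // size_poly_gt0.
have comm0 T j : T =1 (fun=> 0) -> iter j (commutator_with u) T 1 = 0.
  move=> T0; elim: j 1 => [|j IH] f; first exact: T0.
  by rewrite iterS /commutator_with !IH mulr0 subrr.
(* Only the top coefficient survives d commutators, d being the order. *)
have := comm0 _ d M0; rewrite /normal_op iter_commutator_sum sizeM.
rewrite big_ord_recr /= iter_commutator_derivation // eqxx.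
rewrite big1 ?add0r => [|k _]; last first.
  by rewrite iter_commutator_derivation ?(ltnW (ltn_ord k)) // gtn_eqF ?mulr0.
move/eqP; rewrite mulr1 -mulr_natr !mulf_eq0 charA0 expf_eq0 (negPf Du_neq0).
rewrite andbF -lead_coefE lead_coef_eq0 (negPf nzN) /=.
by rewrite gtn_eqF ?fact_gt0.
Qed.

End NormalOrdering.

(** * The operator xD and insertions *)

Section GrammarOperator.
Variables (R : idomainType) (p : R) (D : {linear {mpoly R[2]} -> {mpoly R[2]}}).
Hypothesis D_G : is_grammar_derivation (grammarG p) D.

Let DM f h : D (f * h) = D f * h + f * D h. Proof. by case: D_G. Qed.
Let Dx : D var_x = var_y. Proof. by case: D_G => _ _ _ ->. Qed.
Let Dy : D var_y = p *: var_y. Proof. by case: D_G => _ _ _ ->. Qed.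

Lemma xD_monomial a b (h : {mpoly R[2]}) :
  var_x * D (var_x ^+ a * var_y ^+ b * h) =
  (var_x ^+ a * var_y ^+ b.+1 * h) *+ a
  + p *: (var_x ^+ a.+1 * var_y ^+ b * h) *+ b
  + var_x ^+ a.+1 * var_y ^+ b * D h.
Proof.
have Dexp u k : D (u ^+ k) = (u ^+ k.-1 * D u) *+ k.
  have D1 : D 1 = 0 by case: D_G => _ _ DC _; rewrite -mpolyC1 DC.
  elim: k => [|k IH]; first by rewrite expr0 D1.
  rewrite exprS DM IH mulrS mulrC; congr (_ + _).
  by case: k {IH} => [|k] /=; rewrite ?mulr0n ?mulr0 // mulrnAr mulrA -exprS.
rewrite !DM !Dexp Dx Dy -![p *: _]mul_mpolyC.
by case: a => [|a]; case: b => [|b] /=; rewrite ?exprS; ring.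
Qed.

Definition perm_weight n (s : 'S_n) : {mpoly R[2]} :=
  p ^+ cdes s *: (var_x ^+ (n - exc s) * var_y ^+ exc s).

(** The three terms of [xD_monomial] come from the insertion of the maximum
    after each i with s i <= i, after each excedance, and as a new cycle. *)
Lemma xD_perm_weight n (s : 'S_n) f :
  var_x * D (perm_weight s * iter (cyc s) D f) =
  \sum_j perm_weight (insert_max s j) * iter (cyc (insert_max s j)) D f.
Proof.
have stats := cdes_exc_cyc s.
rewrite (bigD1_ord ord_max) //=.
rewrite /perm_weight insert_max_at_max exc_lift_max cyc_lift_max.
have -> : cdes (lift_perm ord_max ord_max s) = cdes s.
  have := cdes_exc_cyc (lift_perm ord_max ord_max s).
  by rewrite exc_lift_max cyc_lift_max; lia.
rewrite -scalerAl linearZ /= -scalerAr xD_monomial.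
(* The numbers of excedances and cycles determine that of cycle descents. *)
under [X in _ = _ + X]eq_bigr => i _.
  have := cdes_exc_cyc (insert_max s (lift ord_max i)).
  rewrite exc_insert_max cyc_insert_max => stats_i.
  have -> : cdes (insert_max s (lift ord_max i)) = (cdes s + (i < s i))%N.
    by move: stats_i; rewrite ltnNge; case: (s i <= i)%N => /=; lia.
  over.
rewrite subSn; last by lia.
rewrite [LHS]scalerDr addrC -[X in _ = X + _]scalerAl; congr (_ + _).
rewrite (bigID (fun i : 'I_n => (i < s i)%N)) /= addrC scalerDr.
congr (_ + _).
- have cardC_exc : #|[set i : 'I_n | ~~ (i < s i)%N]| = (n - exc s)%N.
    rewrite -[X in (X - _)%N]card_ord -(cardC [pred i : 'I_n | (i < s i)%N]).
    by rewrite /exc !cardsE addKn.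
  rewrite -[X in _ *+ X]cardC_exc -scalerMnr -sumr_const.
  apply: eq_big => i; rewrite inE // => exc_i.
  by rewrite (negPf exc_i) leqNgt exc_i addn0 addn1 subSS scalerAl.
rewrite [X in _ *+ X]/exc -scalerMnr scalerA -sumr_const.
apply: eq_big => i; rewrite inE // => exc_i.
rewrite exc_i leqNgt exc_i addn0 addn1.
by rewrite -exprSr subSn ?exprSr ?scalerAl //; lia.
Qed.

Lemma xD_pow_perm n f :
  wD_pow D var_x n f = \sum_(s : 'S_n) perm_weight s * iter (cyc s) D f.
Proof.
elim: n => [|n IH].
  rewrite (eq_bigr (fun=> f)) => [|s _]; first by rewrite sumr_const card_Sn.
  have := cdes_exc_cyc s; rewrite /perm_weight sub0n.
  case: (cdes s) (exc s) (cyc s) => [|?] [|?] [|?] // _.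
  by rewrite !expr0 scale1r !mul1r.
rewrite /wD_pow iterS -/(wD_pow _ _ _ _) IH raddf_sum mulr_sumr.
under eq_bigr => s _ do rewrite xD_perm_weight.
rewrite pair_bigA /=.
by rewrite [RHS](reindex _ (onW_bij _ (insert_max_bij n))).
Qed.

End GrammarOperator.

Theorem theorem7 (R : idomainType) (charR0 : [pchar R] =i pred0) (p : R)
    (D : {mpoly R[2]} -> {mpoly R[2]})
    (D_G : is_grammar_derivation (grammarG p) D)
    (n : nat) (n_ge1 : (1 <= n)%N) :
  (forall N : {poly {mpoly R[2]}},
     is_normal_ordered_form D (wD_pow D var_x n) N <->
     N = \sum_(s : 'S_n)
           (p ^+ cdes s *: (var_x ^+ (n - exc s) * var_y ^+ exc s))%:P
           * 'X^(cyc s))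
  /\
  (p = 1 ->
   forall A : nat -> nat -> R, is_A_coefficients n A ->
   forall N : {poly {mpoly R[2]}},
     is_normal_ordered_form D (wD_pow D var_x n) N <-> N = A_poly n A).
Proof.
have [Dlin DM _ Dvar] := D_G.
pose DL : {linear {mpoly R[2]} -> {mpoly R[2]}} :=
  HB.pack D (GRing.isLinear.Build _ _ _ _ D Dlin).
have charA0 m : (m%:R == 0 :> {mpoly R[2]}) = (m == 0%N).
  rewrite -mpolyC_nat mpolyC_eq0; exact: (pcharf0P R).1.
have Dx_neq0 : D var_x != 0.
  by rewrite Dvar /= -msize_poly_eq0 msizeX.
(* The exhibited form M is the only one, so the operator being M is enough. *)
have unique N M : (forall f, wD_pow D var_x n f = normal_op DL M f) ->
    is_normal_ordered_form D (wD_pow D var_x n) N <-> N = M.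
  move=> M_nof; split=> [N_nof|-> //].
  apply: (normal_op_inj (D := DL) DM charA0 Dx_neq0) => f.
  by rewrite -M_nof N_nof.
split=> [N|p1 A A_coef N]; apply: unique => f.
  rewrite (xD_pow_perm (D := DL) D_G) normal_op_sum.
  by apply: eq_bigr => s _; rewrite normal_op_monomial.
have D_G' : is_grammar_derivation (@grammarG' R) D.
  case: D_G => ? ? ? DX; split=> // i.
  by rewrite DX /grammarG p1 scale1r; case: ifP.
rewrite (A_coef D D_G') /A_poly normal_op_sum; apply: eq_bigr => k _.
rewrite normal_op_sum; apply: eq_bigr => l _.
by rewrite normal_op_monomial.
Qed.
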